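(* Let $k\ge 2$ be a fixed integer. For each positive integer $n$, place $n$ hyper-rooks at random on the $k$-dimensional chessboard with side length $n$, and let $S_{n,k}$ be the number of safe spaces. Then, as $n\to\infty$, $\mathbb{E}[S_{n,k}]$ is asymptotic to $n^k/e^k$; hence the probability that a space is safe converges to $1/e^k$.
   Context: The $k$-dimensional board of side length $n$ is the set of spaces $\{1,\dots,n\}^k$. ''Placing $n$ pieces at random'' means that the set of occupied spaces (the board configuration) is chosen uniformly among all $\binom{n^k}{n}$ subsets of $n$ distinct spaces. A hyper-rook attacks every space that shares at least one coordinate with it, i.e. a hyper-rook at $(a_1,\dots,a_k)$ attacks $(x_1,\dots,x_k)$ if $x_i=a_i$ for some $i$. A space is safe under a board configuration if it is neither occupied nor attacked by any of the placed pieces. (The probability that a given space is safe is the same for every space of the board.) *)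

(* Defs.v *)
From HB Require Import structures.
From mathcomp Require Import all_boot all_order all_algebra.
From mathcomp Require Import all_classical all_reals all_analysis.

Set Implicit Arguments.
Unset Strict Implicit.
Unset Printing Implicit Defensive.

Import Order.TTheory GRing.Theory Num.Theory.
Import numFieldNormedType.Exports.

Definition board (n k : nat) : finType := {ffun 'I_k -> 'I_n}.

Definition attacks (n k : nat) (a x : board n k) : bool :=
  [exists i : 'I_k, x i == a i].

Definition safe (n k : nat) (A : {set board n k}) (x : board n k) : bool :=
  (x \notin A) && [forall a in A, ~~ attacks a x].

(* The sample space: sets of n distinct occupied spaces. *)
Definition configs (n k : nat) : {set {set board n k}} :=
  [set A : {set board n k} | #|A| == n].

Definition nb_safe (n k : nat) (A : {set board n k}) : nat :=
  #|[set x : board n k | safe A x]|.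

Local Open Scope ring_scope.

(* Probability and expectation for the uniform law on a finite set Omega;
   both are 0 when Omega is empty. *)
Definition unif_prob (R : realType) (T : finType) (Omega : {set T})
    (E : pred T) : R :=
  #|[set w in Omega | E w]|%:R / #|Omega|%:R.

Definition unif_expect (R : realType) (T : finType) (Omega : {set T})
    (X : T -> R) : R :=
  (\sum_(w in Omega) X w) / #|Omega|%:R.

(* E[S_{n,k}] *)
Definition expected_safe (R : realType) (n k : nat) : R :=
  unif_expect (configs n k) (fun A => (nb_safe A)%:R : R).

Definition prob_safe (R : realType) (n k : nat) (x : board n k) : R :=
  unif_prob R (configs n k) (fun A => safe A x).

(* Main.v *)
(* A hyper-rook attacks x iff it shares a coordinate with x, so x is safe iff
   all n rooks lie among the (n-1)^k spaces sharing none.  With N = (n-1)^k and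
   M = n^k, every space is therefore safe with probability C(N,n)/C(M,n), the
   product over i < n of (N-i)/(M-i), which is squeezed between
   ((N-n)/(M-n))^n and (N/M)^n = (1-1/n)^(nk).  Both tend to e^-k when k >= 2,
   and E[S_{n,k}] is n^k times this probability. *)
Require Import Defs.
From HB Require Import structures.
From mathcomp Require Import all_boot all_order all_algebra.
From mathcomp Require Import all_classical all_reals all_analysis.
From mathcomp Require Import ring lra zify.
Import Order.TTheory GRing.Theory Num.Theory.
Import numFieldNormedType.Exports.
Local Open Scope classical_set_scope.
Local Open Scope ring_scope.

(** * Reduction to a ratio of binomial coefficients *)

Lemma card_not_attacking (n k : nat) (x : board n k) :
  #|[set a : board n k | ~~ attacks a x]%SET| = (n.-1 ^ k)%N.
Proof.
rewrite cardsE.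
rewrite (@eq_card _ _ (family (fun i : 'I_k => predC1 (x i)))).
  rewrite card_family foldrE big_map big_enum /=.
  under eq_bigr do rewrite cardC1 card_ord.
  by rewrite prod_nat_const card_ord.
move=> a; rewrite !inE; apply/existsPn/familyP => /= h i.
  by rewrite !inE eq_sym h.
by have := h i; rewrite !inE eq_sym.
Qed.

(** An occupied space is attacked by its own rook, so avoiding attacks already makes a space
    unoccupied. This needs at least one coordinate, hence [0 < k]. *)
Lemma safeE (n k : nat) (A : {set board n k}) (x : board n k) : (0 < k)%N ->
  safe A x = (A \subset [set a : board n k | ~~ attacks a x]%SET).
Proof.
move=> k0; apply/andP/fintype.subsetP => [[_ /forall_inP h] a aA|h].
  by rewrite inE h.
split; last by apply/forall_inP => a /h; rewrite inE.
apply/negP => /h; rewrite inE => /negP; apply; apply/existsP.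
by exists (Ordinal k0).
Qed.

Lemma card_configs (n k : nat) : #|configs n k| = 'C(n ^ k, n).
Proof. by rewrite /configs card_draws card_ffun !card_ord. Qed.

Lemma prob_safeE (R : realType) (n k : nat) (x : board n k) : (0 < k)%N ->
  prob_safe R x = 'C(n.-1 ^ k, n)%:R / 'C(n ^ k, n)%:R.
Proof.
move=> k0; rewrite /prob_safe /unif_prob card_configs.
rewrite -(card_not_attacking _ _ x) -cards_draws; congr (_%:R / _).
by apply: eq_card => A; rewrite !inE safeE// andbC.
Qed.

(** Linearity of expectation: pairs of a configuration and a safe space are counted in both
    orders. *)
Lemma expected_safeE (R : realType) (n k : nat) :
  expected_safe R n k = \sum_(x : board n k) prob_safe R x.
Proof.
rewrite /expected_safe /unif_expect /prob_safe /unif_prob -mulr_suml.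
congr (_ / _); rewrite -!natr_sum; congr _%:R.
under eq_bigr do rewrite /nb_safe -sum1dep_card big_mkcond /=.
rewrite exchange_big /=; apply: eq_bigr => x _.
rewrite -sum1dep_card big_mkcondr /=; apply: eq_bigr => A _.
by case: ifP.
Qed.

Lemma expected_safe_binomial (R : realType) (n k : nat) : (0 < k)%N ->
  expected_safe R n k = n%:R ^+ k * ('C(n.-1 ^ k, n)%:R / 'C(n ^ k, n)%:R).
Proof.
move=> k0; rewrite expected_safeE.
under eq_bigr do rewrite prob_safeE//.
by rewrite sumr_const card_ffun !card_ord -[LHS]mulr_natl natrX.
Qed.

(** * Bounds on ratios of falling factorials *)

Lemma ffact_ratio_ub (N M m : nat) : (N <= M)%N ->
  (N ^_ m * M ^ m <= M ^_ m * N ^ m)%N.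
Proof.
move=> NM; elim: m => [|m IH]; first by rewrite !ffactn0 !expn0.
(* The new factors are split off and compared alone: [(N - m) / (M - m) <= N / M],
   cross-multiplied. *)
rewrite !ffactnSr !expnSr mulnACA [leqRHS]mulnACA; apply: leq_mul => //.
by rewrite !mulnBl (mulnC M N) leq_sub2l// leq_mul2l NM orbT.
Qed.

(** Since [N <= M], the ratio [(N - i) / (M - i)] decreases in [i], so each factor is at least its
    value at [p]. Keeping [p] apart from [m] fixes the bases during the induction; the application
    takes [p = m]. *)
Lemma ffact_ratio_lb (N M p m : nat) : (N <= M)%N -> (m <= p)%N ->
  (M ^_ m * (N - p) ^ m <= N ^_ m * (M - p) ^ m)%N.
Proof.
move=> NM; elim: m => [|m IH] mp; first by rewrite !ffactn0 !expn0.
rewrite !ffactnSr !expnSr mulnACA [leqRHS]mulnACA; apply: leq_mul.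
  exact/IH/ltnW.
(* If [N <= p], truncated subtraction makes the smaller side zero. *)
have [Np|pN] := leqP N p; first by rewrite (eqP Np) muln0.
have -> : (N - m = N - p + (p - m))%N by lia.
have -> : (M - m = M - p + (p - m))%N by lia.
rewrite !mulnDl (mulnC (M - p)%N) leq_add2l leq_mul2l.
by rewrite leq_sub2r ?orbT.
Qed.

(** * Real estimates and limits *)

Section RealBounds.
Variable R : realType.
Implicit Types (x : R).

Lemma bernoulli_ineq (n : nat) x : 0 <= x <= 1 -> 1 - n%:R * x <= (1 - x) ^+ n.
Proof.
move=> /andP[x0 x1]; elim: n => [|n IH]; first by rewrite expr0 mul0r subr0.
have nx0 : 0 <= n%:R * x by rewrite mulr_ge0.
rewrite exprS; apply: (@le_trans _ _ ((1 - x) * (1 - n%:R * x))).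
  by rewrite -natr1; nra.
by rewrite ler_wpM2l// subr_ge0.
Qed.

Lemma bin_ratioE (N M m : nat) :
  'C(N, m)%:R / 'C(M, m)%:R = (N ^_ m)%:R / (M ^_ m)%:R :> R.
Proof.
rewrite -!bin_ffact !natrM -mulf_div divff ?mulr1//.
Qed.

Lemma bin_ratio_ub (N M m : nat) : (0 < M)%N -> (m <= M)%N -> (N <= M)%N ->
  'C(N, m)%:R / 'C(M, m)%:R <= (N%:R / M%:R) ^+ m :> R.
Proof.
move=> M0 mM NM; rewrite bin_ratioE expr_div_n.
rewrite ler_pdivrMr ?ltr0n ?ffact_gt0//.
rewrite mulrAC ler_pdivlMr ?exprn_gt0 ?ltr0n//.
by rewrite -!natrX -!natrM ler_nat [leqRHS]mulnC ffact_ratio_ub.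
Qed.

Lemma bin_ratio_lb (N M m : nat) : (m < M)%N -> (m <= N)%N -> (N <= M)%N ->
  ((N%:R - m%:R) / (M%:R - m%:R)) ^+ m <= 'C(N, m)%:R / 'C(M, m)%:R :> R.
Proof.
move=> mM mN NM; rewrite bin_ratioE expr_div_n -!natrB//; last exact: ltnW.
rewrite ler_pdivlMr ?ltr0n ?ffact_gt0 1?ltnW//.
rewrite mulrAC ler_pdivrMr ?exprn_gt0 ?ltr0n ?subn_gt0//.
by rewrite -!natrX -!natrM ler_nat mulnC ffact_ratio_lb.
Qed.

Lemma pow_ratio_le_expRN1 (n : nat) :
  (n%:R / n.+1%:R) ^+ n.+1 <= expR (- 1) :> R.
Proof.
have m0 : n.+1%:R != 0 :> R by rewrite pnatr_eq0.
have -> : n%:R / n.+1%:R = 1 + - n.+1%:R^-1 :> R.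
  by rewrite -natr1; field; rewrite natr1.
rewrite [in leRHS](_ : -1 = - n.+1%:R^-1 * n.+1%:R :> R); last first.
  by rewrite mulNr mulVf.
rewrite expRM_natr lerXn2r ?nnegrE ?expR_ge0 ?expR_ge1Dx//.
by rewrite subr_ge0 invf_le1 ?ler1n ?ltr0n.
Qed.

(** The inverse of the base is [1 + 1/n <= expR (1/n)], so the power is at least [expR (- (n+1)/n)],
    and [1/n <= 2/(n+1)] for [n >= 1]. The weaker exponent is a function of [1/(n+1)] alone, which
    suits the passage to the limit. *)
Lemma expR_le_pow_ratio (n : nat) : (0 < n)%N ->
  expR (- (1 + 2 * n.+1%:R^-1)) <= (n%:R / n.+1%:R) ^+ n.+1 :> R.
Proof.
move=> n0; have n0' : 0 < n%:R :> R by rewrite ltr0n.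
have n1 : 1 <= n%:R :> R by rewrite ler1n.
apply: (@le_trans _ _ (expR (- n%:R^-1) ^+ n.+1)).
  rewrite -expRM_natr ler_expR -(natr1 n) mulNr lerN2 mulrDr mulVf ?gt_eqF//.
  rewrite mulr1 lerD2l -[leLHS]mul1r ler_pdivrMr// mulrAC ler_pdivlMr; lra.
rewrite lerXn2r ?nnegrE ?expR_ge0 ?divr_ge0//.
rewrite expRN -[leRHS]invrK lef_pV2 ?posrE ?expR_gt0//; last first.
  by rewrite invr_gt0 divr_gt0.
have -> : (n%:R / n.+1%:R)^-1 = 1 + n%:R^-1 :> R.
  by rewrite invf_div -natr1 mulrDl divff ?gt_eqF// mul1r.
exact: expR_ge1Dx.
Qed.

Lemma bin_ratio_le_expR (n k : nat) : (0 < k)%N ->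
  'C(n ^ k, n.+1)%:R / 'C(n.+1 ^ k, n.+1)%:R <= expR (- 1) ^+ k :> R.
Proof.
move=> k0; apply: (@le_trans _ _ (((n ^ k)%:R / (n.+1 ^ k)%:R) ^+ n.+1)).
  apply: bin_ratio_ub; rewrite ?expn_gt0// ?leq_exp2r//.
  by rewrite -{1}[n.+1]expn1 leq_pexp2l.
rewrite !natrX -expr_div_n exprAC lerXn2r ?nnegrE ?expR_ge0 ?exprn_ge0//.
exact: pow_ratio_le_expRN1.
Qed.

(* With m = n+1, M = m^k and N = n^k, (N-m)/(M-m) is N/M times 1-e where
   e = m(M-N)/(N(M-m)), and m e = O(1/m) since M - N <= k M / m, N >= M / 2^k,
   M - m >= M / 2 and M >= m^2. *)
Lemma expR_le_bin_ratio (n k : nat) : (1 < k)%N -> (1 < n)%N ->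
  expR (- (1 + 2 * n.+1%:R^-1)) ^+ k * (1 - k%:R * 2 ^+ k.+1 * n.+1%:R^-1)
  <= 'C(n ^ k, n.+1)%:R / 'C(n.+1 ^ k, n.+1)%:R :> R.
Proof.
move=> k1 n1.
have mN : (n.+1 <= n ^ k)%N.
  by apply: (@leq_trans (n ^ 2)); [nia|rewrite leq_pexp2l// ltnW].
have m2M : (n.+1 ^ 2 <= n.+1 ^ k)%N by rewrite leq_pexp2l.
have NM : (n ^ k <= n.+1 ^ k)%N by rewrite leq_exp2r// ltnW.
have mM : (n.+1 < n.+1 ^ k)%N by nia.
apply: le_trans (bin_ratio_lb _ _ _ mM mN NM).
have NME : (n ^ k)%:R / (n.+1 ^ k)%:R = (n%:R / n.+1%:R) ^+ k :> R.
  by rewrite !natrX expr_div_n.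
set N : R := (n ^ k)%:R in NME *; set M : R := (n.+1 ^ k)%:R in NME *.
set m : R := n.+1%:R in NME *.
have m3 : 3 <= m by rewrite ler_nat.
have mN' : m <= N by rewrite ler_nat.
have NM' : N <= M by rewrite ler_nat.
have m2M' : m ^+ 2 <= M by rewrite -natrX ler_nat.
have mM' : m < M by rewrite ltr_nat.
have nm : n%:R = m - 1 :> R by rewrite /m -natr1 addrK.
have xk : expR (- (1 + 2 * m^-1)) ^+ k <= (n%:R / m) ^+ k ^+ n.+1.
  rewrite exprAC lerXn2r ?nnegrE ?expR_ge0 ?exprn_ge0 ?divr_ge0//.
  by apply: expR_le_pow_ratio; rewrite ltnW.
have mE : n.+1%:R = m by [].
(* From here only the inequalities collected above are used, with [N], [M], [m] opaque to the
   arithmetic tactics. *)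
clearbody N M m.
have M0 : 0 < M by lra.
have mi : 0 < m^-1 by rewrite invr_gt0; lra.
have mi2 : m^-1 <= 2^-1 by rewrite lef_pV2 ?posrE; lra.
have mi1 : m^-1 <= 1 by lra.
have rE : n%:R / m = 1 - m^-1 by rewrite nm mulrBl divff ?mul1r//; lra.
have MN_ub : M - N <= k%:R * m^-1 * M.
  have := @bernoulli_ineq k m^-1; rewrite mi1 (ltW mi) => /(_ isT).
  by rewrite -rE -NME ler_pdivlMr// mulrBl mul1r lerBlDr lerBlDl addrC.
have N_lb : M <= 2 ^+ k * N.
  rewrite -ler_pdivrMl ?exprn_gt0// mulrC.
  rewrite -[N](@divfK _ M); last by rewrite gt_eqF//; lra.
  rewrite mulrC ler_pM2r; last lra.
  rewrite NME -exprVn lerXn2r ?nnegrE ?invr_ge0//.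
    by rewrite rE; lra.
  by rewrite rE; lra.
set e := m * (M - N) / (N * (M - m)).
have ratioE : (N - m) / (M - m) = N / M * (1 - e).
  by rewrite /e; field; rewrite !gt_eqF//; lra.
have e0 : 0 <= e.
  by rewrite /e divr_ge0// mulr_ge0//; lra.
(* Once the denominator is cleared, this reduces to [m * M <= N * M]. *)
have e1 : e <= 1.
  by rewrite ler_pdivrMr ?mul1r; nra.
have me : m * e <= k%:R * 2 ^+ k.+1 * m^-1.
  rewrite /e mulrA ler_pdivrMr; last by apply: mulr_gt0; lra.
  apply: (@le_trans _ _ (m * m * (k%:R * m^-1 * M))).
    by rewrite mulrA ler_wpM2l//; nra.
  apply: (@le_trans _ _ (k%:R * m^-1 * (M * M))).
    rewrite -expr2 [leLHS]mulrCA ler_wpM2l ?mulr_ge0 ?(ltW mi)//.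
    by rewrite ler_wpM2r//; lra.
  rewrite exprS -!mulrA ler_wpM2l// !mulrA [leRHS](_ : _ =
    m^-1 * ((2 ^+ k * N) * (2 * (M - m)))); last by ring.
  rewrite -mulrA ler_wpM2l ?(ltW mi)//.
  by apply: ler_pM; nra.
rewrite ratioE exprMn NME.
have bern : 1 - m * e <= (1 - e) ^+ n.+1.
  by rewrite -mE bernoulli_ineq// e0.
apply: (@le_trans _ _ (expR (- (1 + 2 * m^-1)) ^+ k * (1 - e) ^+ n.+1)).
  by rewrite ler_wpM2l//; lra.
by rewrite ler_wpM2r// exprn_ge0//; lra.
Qed.

Lemma bin_ratio_cvg (k : nat) : (1 < k)%N ->
  ('C(n ^ k, n.+1)%:R / 'C(n.+1 ^ k, n.+1)%:R : R) @[n --> \oo]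
    --> 1 / expR 1 ^+ k.
Proof.
move=> k1; have -> : 1 / expR 1 ^+ k = expR (- 1) ^+ k :> R.
  by rewrite expRN exprVn div1r.
(* The lower bound is [g] at [1/(n+1)]; as [g] is continuous at 0 and [g 0] equals the upper bound,
   the squeeze applies. *)
pose g x := expR (- (1 + 2 * x)) ^+ k * (1 - k%:R * 2 ^+ k.+1 * x).
have g0 : g 0 = expR (- 1) ^+ k by rewrite /g !mulr0 addr0 subr0 mulr1.
apply: (@squeeze_cvgr _ _ _ _ (fun n => g n.+1%:R^-1)
  (fun=> expR (- 1) ^+ k)); last exact: cvg_cst.
  near=> n; rewrite expR_le_bin_ratio//=; last by near: n; exists 2%N.
  by rewrite bin_ratio_le_expR// ltnW.
rewrite -g0; apply: (@continuous_cvg _ _ _ _ _ _ g); last exact: cvg_harmonic.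
apply: cvgM; last first.
  by apply: cvgB; [exact: cvg_cst|apply: cvgMr; exact: cvg_id].
apply: (@continuous_cvg _ _ _ _ _ (fun x : R => expR (- (1 + 2 * x)))
  (fun y : R => y ^+ k)).
  exact: exprn_continuous.
apply: continuous_cvg; first exact: continuous_expR.
by apply: cvgN; apply: cvgD; [exact: cvg_cst|apply: cvgMr; exact: cvg_id].
Unshelve. all: by end_near. Qed.

(** The relative error is [|u n - l| / |l|], which tends to 0. Since [f] is given as a multiple of
    [g], no division by [g] occurs and [g] may vanish. *)
Lemma equiv_mull_cvg (f g u : nat -> R) (l : R) : l != 0 ->
  u n @[n --> \oo] --> l -> (forall n, f n = g n / l * u n) -> f ~_\oo g.
Proof.
move=> l0 ul fE; apply/eqaddoP => e e0.
have le0 : 0 < `|l| * e by rewrite mulr_gt0 ?normr_gt0.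
near=> n.
have un : `|l - u n| <= `|l| * e.
  by near: n; move/cvgrPdist_le : ul; apply.
rewrite !fctE fE -normrN.
have -> : - (g n / l * u n - g n) = (l - u n) / l * g n by field.
rewrite !normrM normfV ler_wpM2r// ler_pdivrMr ?normr_gt0//.
by rewrite mulrC.
Unshelve. all: by end_near. Qed.

End RealBounds.

(* The positive side length is written n.+1. *)
Theorem theorem1p6 (R : realType) (k : nat) (hk : (2 <= k)%N) :
  (fun n : nat => expected_safe R n.+1 k) ~_\oo
    (fun n : nat => n.+1%:R ^+ k / expR 1 ^+ k) /\
  (forall x : forall n : nat, board n.+1 k,
    (fun n : nat => prob_safe R (x n)) @ \oo --> 1 / expR 1 ^+ k).
Proof.
have k0 : (0 < k)%N by exact: ltnW.
have ek0 : expR 1 ^+ k != 0 :> R by rewrite expf_neq0// gt_eqF ?expR_gt0.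
split.
  (* With [l = 1 / expR 1 ^+ k], dividing the target equivalent by [l] restores the number of
     spaces. *)
  apply: equiv_mull_cvg (bin_ratio_cvg R k hk) _.
    by rewrite div1r invr_neq0.
  by move=> n; rewrite expected_safe_binomial// div1r invrK mulfVK.
move=> x; under eq_fun do rewrite prob_safeE//.
exact: bin_ratio_cvg.
Qed.
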